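(* Let $n,k\ge1$ be integers and let $A,A_i\subseteq[0,1]$ for $i\ge1$ be arbitrary subsets. Then, with probability $1$: (i) $R^*_{nA,k}\ge0$ and $R^*_{n\emptyset,k}=0$. (ii) If $A\subseteq\bigcup_{i=1}^\infty A_i$, then $R^*_{nA,1}\le\sum_{i=1}^\infty R^*_{nA_i,1}$. (iii) $R^*_{nA,k+1}\le R^*_{nA,k}\le R^*_{n,k}\le n/k$.
   Context: $\mathbb{Z}_+=\{1,2,\dots\}$. $X_1,X_2,\dots$ are i.i.d. $\mathbb{Z}_+$-valued random variables with $p_i:=\mathbb{P}(X_1=i)>0$ and $p_i\ge p_{i+1}$ for all $i\ge1$ ($X_j$ is the label of the urn hit by ball $j$). For $A\subseteq[0,1]$ and $n\ge1$, $nA=\{na:a\in A\}$ and $R^*_{nA,k}$ is the number of urns $i\ge1$ for which at least $k$ indices $j\in nA\cap\mathbb{Z}_+$ satisfy $X_j=i$. $R^*_{n,k}:=R^*_{n[0,1],k}$. *)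

(* Defs.v *)
From HB Require Import structures.
From mathcomp Require Import all_boot all_order all_algebra finmap.
From mathcomp Require Import all_classical all_reals all_analysis.

Set Implicit Arguments.
Unset Strict Implicit.
Unset Printing Implicit Defensive.
Import Order.TTheory GRing.Theory Num.Theory.

Local Open Scope classical_set_scope.
Local Open Scope card_scope.
Local Open Scope ring_scope.

(* Sequences indexed by the positive integers are functions on [nat] whose
   value at 0 is never used; likewise urns are the natural numbers i >= 1. *)

Section iid.
Context d (T : measurableType d) (R : realType) (P : probability T R).
Context d' (T' : measurableType d').
Variable X : nat -> {RV P >-> T'}.

Definition mutually_independent : Prop :=
  forall (J : {fset nat}) (B : nat -> set T'),
    (forall j, j \in J -> (1 <= j)%N) ->
    (forall j, j \in J -> measurable (B j)) ->
    P (\bigcap_(j in [set` J]) (X j @^-1` B j)) =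
    (\prod_(j <- J) P (X j @^-1` B j))%E.

Definition identically_distributed : Prop :=
  forall j, (1 <= j)%N -> forall B : set T', measurable B ->
    distribution P (X j) B = distribution P (X 1%N) B.

Definition iid : Prop := mutually_independent /\ identically_distributed.

End iid.

Section urns.
Context d (T : measurableType d) (R : realType) (P : probability T R).
Variable X : nat -> {RV P >-> nat}.

Definition dilate (n : nat) (A : set R) : set R := [set n%:R * a | a in A].

Definition balls (C : set R) (i : nat) (w : T) : set nat :=
  [set j | [/\ (1 <= j)%N, C j%:R & X j w = i]].

(* R*_{C,k}, for C a set of reals (C = nA below).  It is extended-real valued
   since for a general C infinitely many urns may be counted. *)
Definition Rstar (C : set R) (k : nat) (w : T) : \bar R :=
  counting [set i | (1 <= i)%N /\ `I_k #<= balls C i w].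

Definition Rstar_full (n k : nat) (w : T) : \bar R :=
  Rstar (dilate n `[0, 1]) k w.

End urns.

(* Main.v *)
Require Import Defs.
From HB Require Import structures.
From mathcomp Require Import all_boot all_order all_algebra finmap.
From mathcomp Require Import all_classical all_reals all_analysis.

Set Implicit Arguments.
Unset Strict Implicit.
Unset Printing Implicit Defensive.
Import Order.TTheory GRing.Theory Num.Theory.

Local Open Scope classical_set_scope.
Local Open Scope ring_scope.
Local Open Scope ereal_scope.

(** All three parts hold surely, that is, at every sample point [w].  Fix [w] and
    call an urn heavy for a set [C] of times when at least [k] balls with index
    in [C] fall into it; [Rstar] is the counting measure of the set of heavy
    urns.

    Monotonicity in [C] and in [k] is monotonicity of that measure
    ([le_Rstar]).  For [k = 1] an urn is heavy as soon as one ball hits it, so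
    it is heavy for a union exactly when it is heavy for one of its members,
    and part (ii) is countable subadditivity of the counting measure
    ([Rstar1_bigcup]).  This breaks for [k > 1], since an urn may collect its
    [k] balls from several members.

    The bound [n / k] is a double count: distinct urns receive disjoint sets of
    balls, each heavy urn uses up at least [k] of them, and at most [n] are
    available ([leq_card_fibers], [Rstar_le_card]). *)

Lemma card_le_II1 (B : set nat) : (`I_1 #<= B)%card <-> B !=set0.
Proof.
split=> [B1|[j Bj]].
  apply/set0P/eqP => B0; move: B1; rewrite B0 card_le0 => /eqP I0.
  by have : `I_1 0%N by []; rewrite I0.
apply: (@card_le_trans _ _ _ [set j]); last by apply: subset_card_le => _ ->.
by have /card_eqPle[] : ([set j] #= `I_1)%card by exact: card_set1.
Qed.

(** The double count, with [f] sending a ball to its urn: the fibres of [f] over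
    distinct points are disjoint, so those over [F] have total size at most that
    of [s]. *)
Lemma leq_card_fibers (I J : choiceType) (f : J -> I) (s : {fset J})
    (F : {fset I}) (k : nat) :
  (forall i, i \in F -> (k <= #|` [fset j in s | f j == i]%fset|)%N) ->
  (#|` F| * k <= #|` s|)%N.
Proof.
move=> kF.
have -> : (#|` F| * k = \sum_(i <- F) k)%N.
  by rewrite card_fset_sum1 big_distrl /=; apply: eq_bigr => i _; rewrite mul1n.
apply: (@leq_trans (\sum_(i <- F) \sum_(j <- s | f j == i) 1)%N).
  rewrite big_seq [X in (_ <= X)%N]big_seq; apply: leq_sum => i iF.
  by rewrite (leq_trans (kF i iF))// card_fset_sum1 big_fset.
rewrite card_fset_sum1.
under eq_bigr do rewrite big_mkcond /=.
rewrite exchange_big /=; apply: leq_sum => j _.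
(* As [F] has no repetition, the ball [j] contributes to at most one summand. *)
rewrite -big_mkcond /= sum1_count (eq_count (a2 := pred1 (f j))).
  by rewrite count_uniq_mem ?fset_uniq// leq_b1.
by move=> i /=; rewrite eq_sym.
Qed.

Section heavy_urns.
Context (d : measure_display) (T : measurableType d) (R : realType).
Context (P : probability T R) (X : nat -> {RV P >-> nat}).
Implicit Types (C D : set R) (k l n : nat) (w : T).

Lemma Rstar_ge0 C k w : 0 <= Rstar X C k w.
Proof. exact: (measure_ge0 counting). Qed.

Lemma le_Rstar C D k l w : C `<=` D -> (k <= l)%N ->
  Rstar X C l w <= Rstar X D k w.
Proof.
move=> CD kl; apply: (le_measure counting); rewrite ?inE// => i [i1 lC].
split=> //; apply: (@card_le_trans _ _ _ `I_l); first by rewrite card_le_II.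
apply: card_le_trans lC _; apply: subset_card_le => j [j1 Cj Xj].
by split=> //; exact: CD.
Qed.

Lemma heavy_urn_hit C i k w : (1 <= k)%N -> (`I_k #<= balls X C i w)%card ->
  balls X C i w !=set0.
Proof.
by move=> k1 kC; apply/card_le_II1; apply: card_le_trans kC; rewrite card_le_II.
Qed.

Lemma Rstar_set0 k w : (1 <= k)%N -> Rstar X set0 k w = 0.
Proof.
move=> k1; rewrite /Rstar [X in counting X](_ : _ = set0) ?(measure0 counting)//.
by rewrite -subset0 => i [_] /(heavy_urn_hit k1)[j []].
Qed.

Lemma Rstar1_bigcup C (C_ : nat -> set R) w :
  C `<=` \bigcup_(i in [set i | (1 <= i)%N]) C_ i ->
  Rstar X C 1 w <= \sum_(1 <= i <oo) Rstar X (C_ i) 1 w.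
Proof.
move=> CC; apply: (measure_sigma_subadditive_tail counting) => // i [i1].
move=> /card_le_II1[j [j1 Cj Xj]]; have [m /= m1 Cmj] := CC _ Cj.
exists m; first by rewrite /= ltnNge; apply/negP; rewrite negbK.
by split=> //; apply/card_le_II1; exists j.
Qed.

Lemma Rstar_le_card C (s : {fset nat}) k w :
  (forall j, (1 <= j)%N -> C j%:R -> j \in s) -> (1 <= k)%N ->
  Rstar X C k w <= (#|` s|%:R / k%:R)%:E.
Proof.
move=> Cs k1; rewrite /Rstar; set U := [set i | _].
have finU : finite_set U.
  (* Since [1 <= k], a heavy urn is the urn of some ball of [s]. *)
  apply: (@sub_finite_set _ _ [set X j w | j in [set` s]]).
    move=> i [_ /(heavy_urn_hit k1)[j [j1 Cj Xj]]].
    by exists j => //; exact: Cs.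
  exact/finite_image/finite_fset.
rewrite /counting asboolT// lee_fin ler_pdivlMr ?ltr0n// -natrM ler_nat.
apply: (leq_card_fibers (f := fun j => X j w)) => i.
rewrite in_fset_set// inE => -[_ kC].
rewrite -[X in #|` X|]set_fsetK; apply: leq_card_fset_set => //.
apply: card_le_trans kC _; apply: subset_card_le => j [j1 Cj Xj] /=.
by rewrite !inE (Cs j) ?Xj/=.
Qed.

End heavy_urns.

Section dilation.
Context (R : realType).
Implicit Types (n : nat) (A : set R).

Lemma dilate_mono n A B : A `<=` B -> dilate n A `<=` dilate n B.
Proof. exact: image_subset. Qed.

Lemma dilate_sub_bigcup n A (A_ : nat -> set R) (I : set nat) :
  A `<=` \bigcup_(i in I) A_ i -> dilate n A `<=` \bigcup_(i in I) dilate n (A_ i).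
Proof. by move=> AA _ [a /AA[i Ii Aia] <-]; exists i => //; exists a. Qed.

Lemma dilate01_le n j : dilate n (`[0%R, 1%R] : set R) j%:R -> (j <= n)%N.
Proof.
move=> [a /=]; rewrite in_itv /= => /andP[_ a1] jE.
by rewrite -(ler_nat R) -jE ler_piMr.
Qed.

End dilation.

Theorem lemma1 (d : measure_display) (T : measurableType d) (R : realType)
  (P : probability T R) (X : nat -> {RV P >-> nat})
  (X_pos : forall (j : nat) (w : T), (1 <= j)%N -> (1 <= X j w)%N)
  (X_iid : iid X)
  (p_pos : forall i : nat, (1 <= i)%N -> 0 < P (X 1%N @^-1` [set i]))
  (p_noninc : forall i : nat, (1 <= i)%N ->
     P (X 1%N @^-1` [set i.+1]) <= P (X 1%N @^-1` [set i]))
  (n k : nat) (n_ge1 : (1 <= n)%N) (k_ge1 : (1 <= k)%N)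
  (A : set R) (A_ : nat -> set R)
  (A01 : A `<=` `[0%R, 1%R])
  (A_01 : forall i : nat, (1 <= i)%N -> A_ i `<=` `[0%R, 1%R]) :
  \forall w \ae P,
    [/\ 0 <= Rstar X (dilate n A) k w /\ Rstar X (dilate n set0) k w = 0,
        A `<=` \bigcup_(i in [set i | (1 <= i)%N]) A_ i ->
        Rstar X (dilate n A) 1 w
          <= \sum_(1 <= i <oo) Rstar X (dilate n (A_ i)) 1 w &
        [/\ Rstar X (dilate n A) k.+1 w <= Rstar X (dilate n A) k w,
            Rstar X (dilate n A) k w <= Rstar_full X n k w &
            Rstar_full X n k w <= (n%:R / k%:R)%:E]].
Proof.
apply: aeW => w; split.
- by split; [exact: Rstar_ge0 | rewrite /dilate image_set0; exact: Rstar_set0].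
- by move=> AA; apply: Rstar1_bigcup; exact: dilate_sub_bigcup.
- split; first exact: le_Rstar.
    by apply: le_Rstar => //; exact: dilate_mono.
  have cn : #|` [fset j in iota 1 n]%fset| = n.
    by rewrite card_fseq undup_id ?iota_uniq// size_iota.
  rewrite -[X in (X%:R / _)%:E]cn; apply: Rstar_le_card => // j j1 /dilate01_le jn.
  by rewrite !inE mem_iota j1 add1n ltnS.
Qed.
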